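(* Let $D$ be a finite set, $\gamma,\gamma_*:D\to\mathbb{R}^d$ maps, and $\lambda_1,\dots,\lambda_n,\lambda_1^*,\dots,\lambda_n^*\in\mathbb{R}^d$. Suppose there are maps $g$ (defined on $\{\gamma(x):x\in D\}$) and $f$ (defined on $\{\lambda_1,\dots,\lambda_n\}$) with values in $\mathbb{R}^d$ such that $\gamma_*(x)=g(\gamma(x))$ for all $x\in D$ and $\lambda_i^*=f(\lambda_i)$ for all $i$. Assume that $\{\gamma(x):x\in D\}$ spans $\mathbb{R}^d$ and that $\{\lambda_1,\dots,\lambda_n\}$ spans $\mathbb{R}^d$. Suppose that for every $x\in D$ and every $i\in\{1,\dots,n\}$ $$\langle g(\gamma(x)),f(\lambda_i)\rangle=\langle\gamma(x),\lambda_i\rangle .$$ Assume also that there exist $d$ linearly independent vectors among $\lambda_1,\dots,\lambda_n$ whose images under $f$ remain linearly independent. Then there exists a unique matrix $A\in\operatorname{GL}(d,\mathbb{R})$ such that $$\gamma_*(x)=A^{-\top}\gamma(x)\ \text{ for all }x\in D,\qquad \lambda_i^*=A\lambda_i\ \text{ for all }i.$$ Equivalently, in terms of readout matrices, $\Lambda_*=\Lambda A^\top$.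
   Context: $\langle\cdot,\cdot\rangle$ is the Euclidean inner product on $\mathbb{R}^d$. $\Lambda,\Lambda_*\in\mathbb{R}^{n\times d}$ are the matrices with rows $\lambda_i^\top$ and $(\lambda_i^* )^\top$ respectively. *)

(* Defs.v *)
From HB Require Import structures.
From mathcomp Require Import all_boot all_order all_algebra.
From mathcomp Require Import reals.

Set Implicit Arguments.
Unset Strict Implicit.
Unset Printing Implicit Defensive.

Import GRing.Theory.
Local Open Scope ring_scope.

Definition dotp (R : realType) (d : nat) (u v : 'cV[R]_d) : R :=
  \sum_(k < d) u k 0 * v k 0.

Definition readout (R : realType) (n d : nat) (lam : 'I_n -> 'cV[R]_d) :
    'M[R]_(n, d) :=
  \matrix_(i < n) (lam i)^T.

(* Main.v *)
(** Let the columns of [L] and [M] be the [d] independent vectors [lambda_i] and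
    their images under [f].  Any admissible [A] satisfies [A L = M], so the only
    candidate is [A = M L^-1].  Preservation of the inner products with these [d]
    vectors reads [M^T gammas x = L^T gamma x], i.e. [gammas x = A^-T gamma x];
    hence [A^-1 (lams i) - lam i] is orthogonal to every [gamma x], and vanishes
    because the [gamma x] span the space. *)

Require Import Defs.
From HB Require Import structures.
From mathcomp Require Import all_boot all_order all_algebra.
From mathcomp Require Import reals.

Set Implicit Arguments.
Unset Strict Implicit.
Unset Printing Implicit Defensive.

Import GRing.Theory.
Local Open Scope ring_scope.

Lemma col_mul (R : pzSemiRingType) (m n p : nat) (k : 'I_p)
    (A : 'M[R]_(m, n)) (B : 'M[R]_(n, p)) :
  col k (A *m B) = A *m col k B.
Proof. by rewrite !colE mulmxA. Qed.

Lemma dotpE (R : realType) (d : nat) (u v : 'cV[R]_d) :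
  dotp u v = (u^T *m v) 0 0.
Proof. by rewrite mxE; apply: eq_bigr => k _; rewrite mxE. Qed.

(** A row vector [v] killing the transposed matrix is the list of coefficients of a linear relation
    among the [c k], so freeness forces [v = 0]. *)
Lemma free_cols_unitmx (R : realType) (d : nat) (c : 'I_d -> 'cV[R]_d) :
  free [seq c k | k : 'I_d] -> \matrix_(i, k) c k i 0 \in unitmx.
Proof.
move=> /(freeP (X := [tuple c k | k < d])) free_c.
rewrite -unitmx_tr -row_free_unit; apply: inj_row_free => v vc0.
apply/rowP => k; rewrite mxE; apply: (free_c (v 0)).
apply/colP => i; move/rowP/(_ i): vc0; rewrite !mxE summxE => vc0.
rewrite -[RHS]vc0; apply: eq_bigr => j _.
by rewrite -tnth_nth tnth_mktuple !mxE.
Qed.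

(** By linearity [w] is orthogonal to every vector of the space; pairing it with the standard basis
    vectors shows that each coordinate is zero. *)
Lemma orthogonal_span_eq0 (R : realType) (d : nat) (D : finType)
    (u : D -> 'cV[R]_d) (w : 'cV[R]_d) :
  <<[seq u x | x : D]>>%VS = fullv -> (forall x, dotp (u x) w = 0) -> w = 0.
Proof.
move=> u_span uw0.
have vw0 (v : 'cV[R]_d) : v^T *m w = 0.
  have /(coord_span (X := in_tuple _)) -> : v \in <<[seq u x | x : D]>>%VS.
    by rewrite u_span memvf.
  rewrite linear_sum mulmx_suml big1 // => i _.
  have /mapP[x _ ->] := mem_nth 0 (ltn_ord i).
  rewrite linearZ -scalemxAl /=; apply/matrixP => a b.
  by rewrite !ord1 mxE -dotpE uw0 mulr0 mxE.
apply/colP => k; have /matrixP/(_ 0 0) := vw0 (delta_mx k 0).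
by rewrite trmx_delta -rowE !mxE.
Qed.

Theorem theoremB1 (R : realType) (d n : nat) (D : finType)
    (gamma gammas : D -> 'cV[R]_d) (lam lams : 'I_n -> 'cV[R]_d)
    (g f : 'cV[R]_d -> 'cV[R]_d)
    (gammasE : forall x : D, gammas x = g (gamma x))
    (lamsE : forall i : 'I_n, lams i = f (lam i))
    (gamma_span : <<[seq gamma x | x : D]>>%VS = fullv)
    (lam_span : <<[seq lam i | i : 'I_n]>>%VS = fullv)
    (dotp_gf : forall (x : D) (i : 'I_n),
       dotp (g (gamma x)) (f (lam i)) = dotp (gamma x) (lam i))
    (lam_free : exists s : 'I_d -> 'I_n,
       free [seq lam (s k) | k : 'I_d] /\ free [seq f (lam (s k)) | k : 'I_d]) :
  (exists! A : 'M[R]_d,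
     [/\ A \in unitmx,
         forall x : D, gammas x = (invmx A)^T *m gamma x
       & forall i : 'I_n, lams i = A *m lam i])
  /\ (forall A : 'M[R]_d,
        (forall i : 'I_n, lams i = A *m lam i)
        <-> readout lams = readout lam *m A^T).
Proof.
split; last first.
  move=> A; split=> [lamsA | /matrixP readoutA i].
    apply/row_matrixP => i.
    by rewrite row_mul !rowK lamsA trmx_mul.
  have /rowP lamsA : row i (readout lams) = row i (readout lam *m A^T).
    by congr row; apply/matrixP.
  apply: trmx_inj; apply/rowP => k.
  by have := lamsA k; rewrite row_mul !rowK trmx_mul.
have [s [lam_s_free f_s_free]] := lam_free.
have L_unit := free_cols_unitmx lam_s_free.
have M_unit := free_cols_unitmx f_s_free.
set L := \matrix_(i, k) _ in L_unit; set M := \matrix_(i, k) _ in M_unit.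
have colL k : col k L = lam (s k) by apply/colP => i; rewrite !mxE.
have colM k : col k M = f (lam (s k)) by apply/colP => i; rewrite !mxE.
have A_unit : M *m invmx L \in unitmx by rewrite unitmx_mul M_unit unitmx_inv.
(* Entry [k] of this row identity is [dotp_gf] at the index [s k]. *)
have MgL x : (gammas x)^T *m M = (gamma x)^T *m L.
  apply/rowP => k; have := dotp_gf x (s k).
  rewrite -colM -colL !dotpE -gammasE -!col_mul.
  by rewrite [LHS]mxE [RHS]mxE.
have gammasA x : (gammas x)^T = (gamma x)^T *m invmx (M *m invmx L).
  apply: (canRL (mulmxK A_unit)).
  by rewrite mulmxA MgL -mulmxA mulmxV // mulmx1.
exists (M *m invmx L); split; first split=> //.
- by move=> x; apply: trmx_inj; rewrite gammasA trmx_mul trmxK.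
(* The inverse is moved onto [lams i] because [gammasA] turns the pairing of [gammas x] with
   [lams i] into that of [gamma x] with [invmx A *m lams i], where [A] is [M *m invmx L]. *)
- move=> i; apply: (canRL (mulKVmx A_unit)); apply/subr0_eq.
  apply: (orthogonal_span_eq0 gamma_span) => x.
  have := dotp_gf x i; rewrite -gammasE -lamsE !dotpE gammasA -mulmxA => gl.
  by rewrite mulmxBr [LHS]mxE gl [X in _ + X]mxE subrr.
move=> B [_ _ lamsB].
(* Uniqueness: [B] sends each column of [L] to the matching column of [M], and [L] can be
   cancelled. *)
suff -> : M = B *m L by rewrite mulmxK.
apply/matrixP => i k.
have : col k M = col k (B *m L) by rewrite col_mul colM colL -lamsE lamsB.
by move/colP/(_ i); rewrite !mxE.
Qed.
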